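(* Let $0<\alpha<1/2$, let $n\ge 2$, and let $S$ be a set of $n$ points in $\mathbb{R}^2$ such that no line contains more than $n^{\alpha}$ points of $S$. Then the number of unordered pairs $\{p,q\}\subset S$ such that $|p-q|\in\mathbb{Q}$ and $\{p,q\}$ has rational angle is at most $n^{1+\alpha+6/\sqrt{\log n}}$, where $\log$ denotes the natural logarithm.
   Context: Identify $\mathbb{R}^2$ with $\mathbb{C}$. A pair of distinct points $p,q$ has rational angle if the segment between them, viewed as the complex number $q-p=re^{\pi i\gamma}$ with $r>0$, has $\gamma\in\mathbb{Q}$; equivalently, the line through $p$ and $q$ makes an angle with the $x$-axis that is a rational multiple of $\pi$. *)

(* Defs.v *)
From Stdlib Require Import Reals Lra List QArith Qreals ClassicalEpsilon.
Open Scope R_scope.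

Definition point : Type := (R * R)%type.

Definition dist2 (p q : point) : R :=
  sqrt ((fst q - fst p) ^ 2 + (snd q - snd p) ^ 2).

Definition is_rational (x : R) : Prop := exists r : Q, x = Q2R r.

Definition rational_angle (p q : point) : Prop :=
  p <> q /\
  exists (r : R) (gamma : Q), 0 < r /\
    fst q - fst p = r * cos (PI * Q2R gamma) /\
    snd q - snd p = r * sin (PI * Q2R gamma).

Definition good_pair (p q : point) : Prop :=
  is_rational (dist2 p q) /\ rational_angle p q.

Definition decP (P : Prop) : bool :=
  if excluded_middle_informative P then true else false.

Definition points_on_line (a b c : R) (S : list point) : nat :=
  length (filter (fun p => decP (a * fst p + b * snd p = c)) S).

(* number of pairs of positions i < j in S whose points form a good pair;
   for S without duplicates this is the number of unordered pairs {p,q} ⊂ S *)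
Fixpoint count_good_pairs (S : list point) : nat :=
  match S with
  | nil => 0
  | x :: S' => (length (filter (fun y => decP (good_pair x y)) S')
                + count_good_pairs S')%nat
  end.

(* Main.v *)
(* If [s = sqrt (ln n)] is at most [6], the bound exceeds [n ^ 2].  Otherwise suppose there are
   too many good pairs.  Passing to a subset of large minimum degree and
   keeping one neighbour per line, every vertex [x] has at least [exp (6 s)] neighbours in
   pairwise different directions.  Count the walks of length [k], with
   [k] about [s], whose steps are irredundant: no nonempty subfamily of the steps sums to [0].
   At most [2 ^ k] neighbours are lost at each step, so some end point is reached by very many
   of them.  A step is a rational multiple of a root of unity.  For two irredundant walks with
   the same ends, each step of the second lies in a minimal vanishing sum that involves a step
   of the first, so Mann's theorem says that up to a rational factor their ratio is a root of
   unity whose order divides the product of the primes up to [2 k].  That product is at most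
   [16 ^ k], and a walk is determined by the directions of its steps, which contradicts the
   lower bound. *)

Require Import Defs.
From Stdlib Require Import Reals List QArith Qreals.
From Stdlib Require Import ZArith Lra ClassicalEpsilon Classical_Prop.
From mathcomp Require all_boot all_order all_algebra all_solvable all_field.
From mathcomp Require ring zify boolp Rstruct complex.

(* The module confines MathComp's notations, which would change the meaning of the
   theorem's statement. *)
Module RationalAngles.

Import all_boot all_order all_algebra all_solvable all_field.
Import mathcomp.algebra_tactics.ring zify boolp Rstruct complex.
Set Implicit Arguments.
Unset Strict Implicit.
Unset Printing Implicit Defensive.
Import Order.TTheory GRing.Theory Num.Theory.
Delimit Scope R_scope with coqR.
Delimit Scope ring_scope with R.
Local Open Scope ring_scope.

(** * Mann's theorem *)

Lemma map_ratr_int (F : numFieldType) (p : {poly int}) :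
  map_poly ratr (map_poly (intr : int -> rat) p) = map_poly intr p :> {poly F}.
Proof.
by rewrite -map_poly_comp; apply: eq_map_poly => x /=; rewrite ratr_int.
Qed.

(** As X^n - 1 is the product of the ['Phi_d] with d dividing n, some ['Phi_d] vanishes at [z]. Then
    z^d = 1, and primitivity gives d = n. *)
Lemma root_Cyclotomic_prim (F : numFieldType) n (z : F) :
  n.-primitive_root z -> root (map_poly intr 'Phi_n) z.
Proof.
move=> prim_z; have n_gt0 := prim_order_gt0 prim_z.
have : root (map_poly intr ('X^n - 1 : {poly int})) z.
  by rewrite rmorphB rmorph1 /= map_polyXn rootE !hornerE (prim_expr_order prim_z) subrr.
rewrite -prod_Cyclotomic // rmorph_prod /= rootE horner_prod prodf_seq_eq0.
case/hasP=> d; rewrite -dvdn_divisors //= => dvd_dn root_d.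
suff zd1 : z ^+ d = 1.
  suff /eqP <- : d == n by [].
  by rewrite eqn_dvd dvd_dn (prim_order_dvd prim_z) zd1 eqxx.
have d_gt0 := dvdn_gt0 n_gt0 dvd_dn.
have : root (map_poly intr ('X^d - 1 : {poly int})) z.
  rewrite -prod_Cyclotomic // rmorph_prod /= rootE horner_prod prodf_seq_eq0.
  by apply/hasP; exists d => //; rewrite -dvdn_divisors.
by rewrite rmorphB rmorph1 /= map_polyXn rootE !hornerE subr_eq0 => /eqP.
Qed.

(** Over [rat], ['Phi_n] is the minimal polynomial of a primitive root [z] in [algC]. In a
    factorization [z] is a root of one factor, which the minimal polynomial then divides; by degree
    the other factor is constant. *)
Lemma irreducible_Cyclotomic n : (n > 0)%N ->
  irreducible_poly (map_poly (intr : int -> rat) 'Phi_n).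
Proof.
move=> n_gt0; have [z prim_z] := C_prim_root_exists n_gt0.
have [p [Dp mon_p] dv_p] := minCpolyP z.
have Phip : map_poly intr 'Phi_n = p.
  apply: (map_poly_inj (ratr : {rmorphism rat -> algC})).
  rewrite /= map_ratr_int -Dp (minCpoly_cyclotomic prim_z).
  exact: (Cintr_Cyclotomic prim_z).
rewrite Phip; split=> [|q sz_q q_dvd].
  by have := size_minCpoly z; rewrite Dp size_map_poly.
have nzp : p != 0 by rewrite monic_neq0.
have /dvdpP[r Dr] := q_dvd.
have := root_minCpoly z; rewrite Dp Dr rmorphM rootM /= orbC.
case/orP=> [|rz]; first by rewrite dv_p -Dr => p_dvd; rewrite /eqp q_dvd.
have p_dvd_r : p %| r by rewrite -dv_p.
have nzr : r != 0 by apply: contraNneq nzp => r0; rewrite Dr r0 mul0r.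
have nzq : q != 0 by apply: contraNneq nzp => q0; rewrite Dr q0 mulr0.
have := dvdp_leq nzr p_dvd_r; rewrite Dr size_mul //.
case: (size q) sz_q (size_poly_gt0 q) => [|[|m]] //; first by rewrite nzq.
by move=> _ _; rewrite !addnS /= -addSn leqNgt ltn_addr // .
Qed.

(* Irreducibility of the cyclotomic polynomial replaces the Galois action. *)
Lemma root_prim_exp (F : numFieldType) n (z : F) k (q : {poly rat}) :
  n.-primitive_root z -> coprime k n ->
  root (map_poly ratr q) z -> root (map_poly ratr q) (z ^+ k).
Proof.
move=> prim_z co_kn qz0; have n_gt0 := prim_order_gt0 prim_z.
pose P := map_poly (intr : int -> rat) 'Phi_n.
have irrP : irreducible_poly P := irreducible_Cyclotomic n_gt0.
have PhiP w : n.-primitive_root w -> (map_poly ratr P : {poly F}).[w] = 0.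
  by move=> prim_w; rewrite map_ratr_int; apply/rootP/root_Cyclotomic_prim.
have [co|ncoPq] := boolP (coprimep P q).
  case/negP: (oner_neq0 F); have [[u v]] := Bezout_eq1_coprimepP _ _ co.
  move/(congr1 (fun p => (map_poly ratr p : {poly F}).[z])) => /=.
  rewrite rmorphD !rmorphM rmorph1 /= !hornerE.
  by rewrite (PhiP _ prim_z) (rootP qz0) !mulr0 addr0 => <-.
have /andP[_ P_dvd] := irrP.2 _ ncoPq (dvdp_gcdl P q).
have /dvdpP[r ->] := dvdp_trans P_dvd (dvdp_gcdr P q).
by apply/rootP; rewrite rmorphM /= hornerM (PhiP (z ^+ k)) ?mulr0 ?prim_root_exp_coprime.
Qed.

(** X^n - 1 splits and, in characteristic 0, is separable, so it has n distinct roots; n distinct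
    n-th roots of unity include a primitive one. *)
Lemma closed_prim_root (F : numClosedFieldType) n : (n > 0)%N ->
  exists z : F, n.-primitive_root z.
Proof.
move=> n_gt0; pose p : {poly F} := 'X^n - 1.
have [r Dp] := closed_field_poly_normal p.
rewrite (monicP _) ?monicXnsubC // scale1r in Dp.
have sz_r : size r = n.
  by apply: succn_inj; rewrite -(size_prod_XsubC _ id) -Dp size_XnsubC.
have /hasP[z _ pz] : has n.-primitive_root r; last by exists z.
apply: has_prim_root => //; last by rewrite sz_r.
- by apply/allP=> z; rewrite -root_prod_XsubC -Dp unity_rootE rootE !hornerE subr_eq0.
- by rewrite -separable_prod_XsubC -Dp separable_Xn_sub_1 // pnatr_eq0 -lt0n.
Qed.

Section Mann.
Variables (F : numClosedFieldType) (I : finType) (A : {set I}).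
Variables (a : I -> rat) (w : I -> F).
Hypothesis sum0 : \sum_(i in A) ratr (a i) * w i = 0.
Hypothesis minA : forall B : {set I}, B \proper A -> B != set0 ->
  \sum_(i in B) ratr (a i) * w i != 0.

(* The discrete Fourier transform isolates the terms with [w i ^+ M = eta ^+ s]. *)
Lemma mann_dft p M u0 s (eta : F) :
  p.-primitive_root eta -> (s < p)%N ->
  (forall i, i \in A -> w i ^+ M ^+ p = 1) ->
  (forall u, (u < p)%N -> u != u0 ->
     \sum_(i in A) ratr (a i) * w i ^+ (1 + M * u) = 0) ->
  (u0 < p)%N ->
  p%:R * \sum_(i in A | w i ^+ M == eta ^+ s) ratr (a i) * w i =
  eta ^- (s * u0) * \sum_(i in A) ratr (a i) * w i ^+ (1 + M * u0).
Proof.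
move=> prim_eta lt_sp wMp c0 lt_u0; have p_gt0 := prim_order_gt0 prim_eta.
have nz_eta k : eta ^+ k != 0 by rewrite expf_neq0 // (prim_root_eq0 prim_eta) -lt0n.
transitivity (\sum_(u < p) eta ^- (s * u) * \sum_(i in A) ratr (a i) * w i ^+ (1 + M * u)).
  symmetry; under eq_bigr do rewrite mulr_sumr.
  rewrite exchange_big /= mulr_sumr [LHS](bigID (fun i => w i ^+ M == eta ^+ s)) /=.
  rewrite [X in _ + X = _]big1 ?addr0 => [|i /andP[iA ne]].
    apply: eq_bigr => i /andP[iA /eqP eq_i].
    under eq_bigr => u _.
      rewrite exprD expr1 (exprM (w i)) eq_i -exprM [_ * (w i * _)]mulrA.
      by rewrite mulrCA mulVf ?mulr1 //; over.
    by rewrite /= sumr_const card_ord mulr_natl.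
  (* Outside the class of [s], [x] is a p-th root of unity other than 1, so its powers sum to 0. *)
  pose x := w i ^+ M / eta ^+ s.
  have xp1 : x ^+ p = 1.
    by rewrite expr_div_n wMp // -exprM mulnC exprM (prim_expr_order prim_eta) expr1n divr1.
  have nx1 : x - 1 != 0.
    rewrite subr_eq0; apply: contra ne => /eqP xe.
    by rewrite -[_ == _](inj_eq (mulIf (invr_neq0 (nz_eta s)))) divff // -xe.
  have sx0 : \sum_(u < p) x ^+ u = 0.
    by apply: (mulfI nx1); rewrite -subrX1 xp1 subrr mulr0.
  transitivity (ratr (a i) * w i * \sum_(u < p) x ^+ u); last by rewrite sx0 mulr0.
  rewrite mulr_sumr; apply: eq_bigr => u _.
  rewrite expr_div_n -!exprM exprD expr1; ring.
rewrite (bigD1 (Ordinal lt_u0)) //= [X in _ + X]big1 ?addr0 // => u ne.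
by rewrite c0 ?mulr0 // (contraNneq _ ne).
Qed.

(** The descent step: a prime [p] whose square divides [N], or that exceeds the number of terms, can
    be removed from the common order. The sums [c u] are conjugates of the vanishing sum whenever
    [1 + M * u] is coprime to [N]. Once all of them vanish, Fourier inversion splits the sum into
    vanishing classes, and minimality leaves only the class of [i0]. *)
Lemma mann_step N p i0 : (N > 0)%N -> prime p -> (p %| N)%N ->
  (p %| N %/ p)%N || (#|A| < p)%N ->
  (forall i, i \in A -> w i ^+ N = 1) -> i0 \in A -> w i0 = 1 ->
  forall i, i \in A -> w i ^+ (N %/ p) = 1.
Proof.
move=> N_gt0 p_pr p_dvd bigp wN1 i0A w01; set M := (N %/ p)%N in bigp *.
have defN : (N = M * p)%N by rewrite divnK.
have p_gt0 := prime_gt0 p_pr.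
have [z prim_z] := closed_prim_root F N_gt0.
have prim_eta : p.-primitive_root (z ^+ M) := dvdn_prim_root prim_z p_dvd.
set eta := z ^+ M in prim_eta.
have [e we] : exists e : I -> 'I_N, forall i, i \in A -> w i = z ^+ e i.
  apply: (fin_all_exists (P := fun i (k : 'I_N) => i \in A -> w i = z ^+ k)) => i.
  have [iA|] := boolP (i \in A); last by exists (Ordinal N_gt0).
  by have [k ->] := prim_rootP prim_z (wN1 i iA); exists k.
have wM i : i \in A -> w i ^+ M = eta ^+ e i.
  by move=> iA; rewrite we // /eta -!exprM mulnC.
have wMp i : i \in A -> w i ^+ M ^+ p = 1 by move=> iA; rewrite -exprM -defN wN1.
pose c u := \sum_(i in A) ratr (a i) * w i ^+ (1 + M * u).
have c_cop u : coprime (1 + M * u) N -> c u = 0.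
  move=> co; pose q := \sum_(i in A) a i *: 'X^(e i).
  have qE y : (map_poly ratr q : {poly F}).[y] = \sum_(i in A) ratr (a i) * y ^+ e i.
    rewrite rmorph_sum horner_sum; apply: eq_bigr => i _ /=.
    by rewrite linearZ /= map_polyXn !hornerE.
  have := @root_prim_exp F N z _ q prim_z co; rewrite !rootE !qE => cE.
  rewrite /c; transitivity (\sum_(i in A) ratr (a i) * (z ^+ (1 + M * u)) ^+ e i).
    by apply: eq_bigr => i iA; rewrite we // -!exprM mulnC.
  apply/eqP/cE; rewrite -[X in _ == X]sum0; apply/eqP.
  by apply: eq_bigr => i iA; rewrite we.
have cop_p u : ~~ (p %| 1 + M * u)%N -> c u = 0.
  move=> ndv; apply: c_cop; rewrite defN coprimeMr [coprime _ p]coprime_sym.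
  rewrite (prime_coprime _ p_pr) ndv andbT.
  by rewrite /coprime gcdnC addnC mulnC gcdnMDl gcdn1.
have c0 u : (u < p)%N -> c u = 0.
  move=> lt_up; have [u0_dvd|/cop_p //] := boolP (p %| 1 + M * u)%N.
  (* In this case [p] does not divide [M], so [u] is the only index below [p] with [1 + M * u]
     divisible by [p], and [p] exceeds the number of terms. *)
  have ndvM : ~~ (p %| M)%N.
    apply: contraL u0_dvd => dvM; rewrite dvdn_addl ?dvdn_mulr // dvdn1.
    by rewrite neq_ltn prime_gt1 ?orbT.
  rewrite (negPf ndvM) /= in bigp.
  have c_ne v : (v < p)%N -> v != u -> c v = 0.
    move=> lt_vp ne; apply: cop_p; apply: contra ne => v_dvd.
    have : (1 + M * v == 1 + M * u %[mod p])%N by rewrite (eqP v_dvd) (eqP u0_dvd).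
    rewrite eqn_modDl.
    have [le_vu|/ltnW le_uv] := leqP v u.
      rewrite eq_sym eqn_mod_dvd ?leq_mul2l ?le_vu ?orbT // -mulnBr Euclid_dvdM // (negPf ndvM) /=.
      move=> dv; rewrite eqn_leq le_vu /= -subn_eq0; case: posnP dv => // gt0 /(dvdn_leq gt0).
      by rewrite leqNgt (leq_ltn_trans (leq_subr _ _)).
    rewrite eqn_mod_dvd ?leq_mul2l ?le_uv ?orbT // -mulnBr Euclid_dvdM // (negPf ndvM) /=.
    move=> dv; rewrite eqn_leq le_uv andbT -subn_eq0; case: posnP dv => // gt0 /(dvdn_leq gt0).
    by rewrite leqNgt (leq_ltn_trans (leq_subr _ _)).
  (* Fewer than [p] terms leave some class [s] empty, and the transform at [s] then kills
     the only [c u] that conjugation does not reach. *)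
  pose f i := Ordinal (ltn_pmod (e i) p_gt0).
  have [s s_new] : exists s, s \notin f @: A.
    apply/existsP; rewrite -negb_forall; apply: contraL bigp => /forallP all_s.
    rewrite -leqNgt; apply: leq_trans (leq_imset_card f A).
    by rewrite -[X in (X <= _)%N](card_ord p); apply/subset_leq_card/subsetP => s _.
  have := mann_dft prim_eta (ltn_ord s) wMp c_ne lt_up.
  rewrite big1 ?mulr0 => [/esym/eqP|i /andP[iA /eqP]].
    rewrite mulf_eq0 invr_eq0 expf_eq0 (prim_root_eq0 prim_eta).
    by rewrite [p == 0%N]gtn_eqF // andbF => /eqP.
  rewrite wM // => /eqP; rewrite (eq_prim_root_expr prim_eta) => /eqP es.
  case/negP: s_new; apply/imsetP; exists i => //; apply: val_inj => /=.
  by rewrite es modn_small.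
(* This is the class [s = 0]; it contains [i0] because [w i0 = 1]. *)
pose B := [set i in A | w i ^+ M == 1].
have sumB : \sum_(i in B) ratr (a i) * w i = 0.
  have := mann_dft prim_eta p_gt0 wMp (fun u lt_u _ => c0 u lt_u) p_gt0.
  rewrite -/(c 0%N) c0 // mulr0 => /eqP; rewrite mulf_eq0 pnatr_eq0 gtn_eqF //= => /eqP {2}<-.
  by apply: eq_bigl => i; rewrite inE expr0.
have i0B : i0 \in B by rewrite inE i0A w01 expr1n eqxx.
have sBA : B \subset A by apply/subsetP => i; rewrite inE => /andP[].
have BA : B = A.
  apply/eqP; apply: contraT => neBA; have := minA (B := B).
  rewrite properEneq neBA sBA sumB eqxx => /(_ isT); apply.
  by apply/set0Pn; exists i0.
by move=> i; rewrite -{1}BA inE => /andP[_ /eqP].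
Qed.

End Mann.

(** * Primorials, and the descent to Mann's theorem *)

Lemma prime_prod_dvd (s : seq nat) X : uniq s ->
  (forall p, p \in s -> prime p /\ (p %| X)%N) -> (\prod_(p <- s) p %| X)%N.
Proof.
elim: s => [|p s IHs] /= => [_ _|/andP[p_notin uniq_s] sP]; first by rewrite big_nil dvd1n.
have [p_pr p_dvd] := sP p (mem_head _ _).
rewrite big_cons Gauss_dvd ?p_dvd ?IHs // => [q q_s|]; first by apply: sP; rewrite inE q_s orbT.
rewrite big_seq; elim/big_rec: _ => [|q x q_s co]; first exact: coprimen1.
have [q_pr _] : prime q /\ (q %| X)%N by apply: sP; rewrite inE q_s orbT.
rewrite coprimeMr co andbT prime_coprime // dvdn_prime2 //.
by apply: contraNneq p_notin => ->.
Qed.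

Definition primorial n : nat := (\prod_(0 <= p < n.+1 | prime p) p)%N.

Lemma primorial_gt0 n : (0 < primorial n)%N.
Proof. by apply: prodn_cond_gt0 => p; apply: prime_gt0. Qed.

(** The two middle coefficients are equal and both occur in the expansion of (1 + 1)^(2m+1). *)
Lemma binomial_odd_le m : ('C(m.*2.+1, m) <= 4 ^ m)%N.
Proof.
have : (2 * 'C(m.*2.+1, m) <= 2 ^ m.*2.+1)%N.
  rewrite -[X in (_ <= X ^ _)%N]/(1 + 1)%N expnDn.
  have lt_m : (m < m.*2.+2)%N by lia.
  have lt_m1 : (m.+1 < m.*2.+2)%N by lia.
  rewrite (bigD1 (Ordinal lt_m)) //= (bigD1 (Ordinal lt_m1)) /=; last first.
    by rewrite -val_eqE /= -[X in _ == X]addn0 -addn1 eqn_add2l.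
  rewrite !exp1n !muln1 addnA mul2n -addnn; apply: leq_trans (leq_addr _ _).
  rewrite leq_add2l -bin_sub; last by lia.
  by rewrite [(_ - m)%N](_ : _ = m.+1) //; lia.
by rewrite expnS leq_pmul2l // -mul2n expnM.
Qed.

(** Erdős's argument. An even n > 2 contributes no prime. For n = 2m + 1, the primes from m + 2 to n
    all divide the binomial coefficient C(2m+1, m), which is at most 4^m, and induction at m + 1
    bounds the rest. *)
Lemma primorial_le n : (primorial n <= 4 ^ n)%N.
Proof.
elim/ltn_ind: n => n IHn.
case: (ltnP n 3) => [|n_ge3].
  by case: n {IHn} => [|[|[|n]]] // _; rewrite /primorial unlock.
have [n_odd|n_even] := boolP (odd n); last first.
  rewrite /primorial big_mkcond big_nat_recr //= ifN ?muln1; last first.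
    by apply/negP => /even_prime[n2|n_odd]; [rewrite n2 in n_ge3|rewrite n_odd in n_even].
  rewrite -big_mkcond; case: n n_ge3 IHn n_even => // n _ IHn _.
  by apply: leq_trans (IHn _ (ltnSn _)) _; rewrite leq_exp2l.
pose m := n./2; have defn : n = m.*2.+1 by rewrite -[LHS]odd_double_half n_odd.
have m_gt0 : (0 < m)%N by lia.
rewrite /primorial (big_cat_nat _ (n := m.+2)) //=; last by lia.
apply: (@leq_trans (4 ^ m.+1 * 4 ^ m)); last by rewrite -expnD leq_exp2l //; lia.
apply: leq_mul; first by apply: IHn; lia.
apply: leq_trans (binomial_odd_le m); apply: dvdn_leq; first by rewrite bin_gt0; lia.
rewrite -big_filter; apply: prime_prod_dvd; first by rewrite filter_uniq ?iota_uniq.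
move=> p; rewrite mem_filter mem_index_iota => /and3P[p_pr le_mp lt_pn]; split=> //.
have p_ndvd k : (k < p)%N -> ~~ (p %| k`!)%N.
  elim: k => [|k IHk] lt_kp; first by rewrite dvdn1 neq_ltn prime_gt1 ?orbT.
  rewrite factS Euclid_dvdM // negb_or IHk ?andbT; last exact: ltnW.
  by apply/negP => /dvdn_leq; lia.
have le_m : (m <= m.*2.+1)%N by lia.
have := bin_fact le_m; have : (p %| (m.*2.+1)`!)%N by rewrite dvdn_fact // prime_gt0 //=; lia.
move=> dv defB; rewrite -defB !Euclid_dvdM // (negPf (p_ndvd _ _)) /= in dv; last by lia.
by rewrite (negPf (p_ndvd _ _)) ?orbF in dv; lia.
Qed.

(** The hypothesis says that [N] is squarefree with prime factors at most [k], so every nontrivial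
    p-part of [N] is [p] itself. *)
Lemma dvdn_primorial N k : (N > 0)%N ->
  (forall p, prime p -> p %| N -> (p <= k) && ~~ (p %| N %/ p))%N -> (N %| primorial k)%N.
Proof.
move=> N_gt0 sqfree; apply/dvdn_partP => // p; rewrite mem_primes => /and3P[p_pr _ p_dvd].
have /andP[le_pk ndv] := sqfree p p_pr p_dvd.
have -> : (N`_p = p)%N.
  rewrite p_part; suff -> : logn p N = 1%N by [].
  apply/eqP; rewrite eqn_leq logn_gt0 mem_primes p_pr N_gt0 p_dvd /= andbT leqNgt.
  apply: contra ndv => log_gt1; have : (p ^ 2 %| N)%N by rewrite pfactor_dvdn.
  by rewrite -{1}(divnK p_dvd) expnS expn1 dvdn_pmul2r ?prime_gt0.
rewrite /primorial big_mkcond (big_rem p) /= ?mem_index_iota ?ltnS //.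
by rewrite p_pr dvdn_mulr.
Qed.

(** Strong induction on [N]: [mann_step] removes bad primes one at a time, and an [N] without bad
    primes is squarefree with prime factors at most [#|A|]. *)
Lemma mann_normalized (F : numClosedFieldType) (I : finType) (A : {set I})
    (a : I -> rat) (w : I -> F) N i0 :
  \sum_(i in A) ratr (a i) * w i = 0 ->
  (forall B : {set I}, B \proper A -> B != set0 ->
     \sum_(i in B) ratr (a i) * w i != 0) ->
  (N > 0)%N -> (forall i, i \in A -> w i ^+ N = 1) -> i0 \in A -> w i0 = 1 ->
  forall i, i \in A -> w i ^+ primorial #|A| = 1.
Proof.
move=> sum0 minA; elim/ltn_ind: N => N IHN N_gt0 wN1 i0A w01.
pose bad p := ((p %| N %/ p) || (#|A| < p))%N.
have [/hasP[p]|/hasPn good] := boolP (has bad (primes N)).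
  rewrite mem_primes => /and3P[p_pr _ p_dvd] bad_p.
  have wp1 := mann_step sum0 minA N_gt0 p_pr p_dvd bad_p wN1 i0A w01.
  apply: (IHN (N %/ p)%N) => //; first by rewrite ltn_Pdiv ?prime_gt1.
  by rewrite divn_gt0 ?prime_gt0 // dvdn_leq.
move=> i iA; have /dvdnP[q ->] : (N %| primorial #|A|)%N.
  apply: dvdn_primorial => // p p_pr p_dvd.
  have /norP[ndv le_pA] : ~~ bad p by apply: good; rewrite mem_primes p_pr N_gt0.
  by rewrite leqNgt le_pA.
by rewrite mulnC exprM wN1 // expr1n.
Qed.

(** Dividing every term by [w j] normalizes one term to 1 and preserves minimality. *)
Lemma mann (F : numClosedFieldType) (I : finType) (A : {set I})
    (a : I -> rat) (w : I -> F) N i j :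
  \sum_(i in A) ratr (a i) * w i = 0 ->
  (forall B : {set I}, B \proper A -> B != set0 ->
     \sum_(i in B) ratr (a i) * w i != 0) ->
  (N > 0)%N -> (forall i, i \in A -> w i ^+ N = 1) -> i \in A -> j \in A ->
  (w i / w j) ^+ primorial #|A| = 1.
Proof.
move=> sum0 minA N_gt0 wN1 iA jA.
have wj0 : w j != 0.
  by apply: contra_eqN (wN1 j jA) => /eqP ->; rewrite expr0n gtn_eqF // eq_sym oner_eq0.
have scale (B : {set I}) :
    \sum_(k in B) ratr (a k) * (w k / w j) = (\sum_(k in B) ratr (a k) * w k) / w j.
  by rewrite mulr_suml; apply: eq_bigr => k _; rewrite mulrA.
apply: (@mann_normalized F I A a (fun k => w k / w j) N j) => //; last by rewrite divff.
- by rewrite scale sum0 mul0r.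
- by move=> B prB neB; rewrite scale mulf_neq0 ?invr_eq0 // minA.
- by move=> k kA; rewrite expr_div_n !wN1 // divr1.
Qed.

(** * Irredundant families *)

Definition mult_of_unity_root (F : numClosedFieldType) (v : F) : Prop :=
  exists (a : rat) (N : nat) (w : F), [/\ (N > 0)%N, w ^+ N = 1 & v = ratr a * w].

Fixpoint subset_sums (F : nmodType) (vs : seq F) : seq F :=
  if vs is v :: vs' then subset_sums vs' ++ [seq v + s | s <- subset_sums vs'] else [:: 0].

(** No nonempty subfamily sums to 0, tested one head at a time: a vanishing subfamily through the
    head [v] makes [- v] a subset sum of the tail. In this form the forbidden values of a new head
    are visibly at most 2^k. *)
Fixpoint irredundant (F : zmodType) (vs : seq F) : bool :=
  if vs is v :: vs' then (- v \notin subset_sums vs') && irredundant vs' else true.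

Lemma size_subset_sums (F : nmodType) (vs : seq F) : size (subset_sums vs) = (2 ^ size vs)%N.
Proof. by elim: vs => //= v vs IH; rewrite size_cat size_map IH expnS mul2n addnn. Qed.

(** Subfamilies are predicates on positions, since values may repeat; passing to the tail shifts the
    predicate by one. *)
Lemma mem_subset_sums (F : nmodType) (vs : seq F) (P : pred nat) :
  \sum_(i < size vs | P i) vs`_i \in subset_sums vs.
Proof.
elim: vs P => [|v vs IH] P /=; first by rewrite big_ord0 inE.
rewrite big_mkcond big_ord_recl /= -big_mkcond mem_cat.
have := IH (fun i => P i.+1); case: (P 0%N) => mem_s; last by rewrite add0r mem_s.
by apply/orP; right; apply: map_f.
Qed.

Lemma irredundantP (F : zmodType) (vs : seq F) (P : pred nat) :
  irredundant vs -> \sum_(i < size vs | P i) vs`_i = 0 ->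
  forall i, (i < size vs)%N -> ~~ P i.
Proof.
elim: vs P => [|v vs IH] P //= /andP[nv irr].
rewrite big_mkcond big_ord_recl /= -big_mkcond.
have mem_s := mem_subset_sums vs (fun i => P i.+1).
case P0 : (P 0%N) => sum0.
  by case/negP: nv; rewrite (addr0_eq sum0).
rewrite add0r in sum0; case=> [_|i lt_i]; first by rewrite P0.
exact: (IH (fun i => P i.+1)).
Qed.

Lemma irredundant_neq0 (F : zmodType) (vs : seq F) i :
  irredundant vs -> (i < size vs)%N -> vs`_i != 0.
Proof.
move=> irr lt_i; apply/eqP => vi0.
have sum0 : \sum_(k < size vs | pred1 i (k : nat)) vs`_k = 0.
  by rewrite (big_pred1 (Ordinal lt_i)).
by have := irredundantP irr sum0 lt_i; rewrite /= eqxx.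
Qed.

Lemma primorial_dvd m n : (m <= n)%N -> (primorial m %| primorial n)%N.
Proof. by move=> le_mn; rewrite /primorial (@big_cat_nat _ _ _ m.+1 0 n.+1) // dvdn_mulr. Qed.

(** The terms of [vs] and the negated terms of [ws] together sum to 0. A minimal vanishing subfamily
    through a given term of [ws] must also meet [vs], because [ws] is irredundant; Mann's theorem
    then compares the two terms. *)
Lemma mann_compare (F : numClosedFieldType) (vs ws : seq F) (xi : F) P :
  irredundant vs -> irredundant ws -> \sum_(v <- vs) v = \sum_(w <- ws) w ->
  {in vs, forall v, mult_of_unity_root v} -> {in ws, forall w, mult_of_unity_root w} ->
  (primorial (size vs + size ws) %| P)%N -> P.-primitive_root xi ->
  forall w, w \in ws ->
  exists2 v, v \in vs & exists q : rat, exists2 t, (t < P)%N & w = ratr q * (v * xi ^+ t).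
Proof.
move=> irr_vs irr_ws eq_sum vsU wsU P_dvd prim_xi y y_ws.
pose I : finType := ('I_(size vs) + 'I_(size ws))%type.
pose f (i : I) := match i with inl k => vs`_k | inr k => - ws`_k end.
have fU i : exists c : rat * nat * F, [/\ (c.1.2 > 0)%N, c.2 ^+ c.1.2 = 1 & f i = ratr c.1.1 * c.2].
  case: i => k /=.
    by have [a [N [w [? ? ?]]]] := vsU _ (mem_nth 0 (ltn_ord k)); exists (a, N, w).
  have [a [N [w [? ? ->]]]] := wsU _ (mem_nth 0 (ltn_ord k)).
  by exists (- a, N, w); rewrite /= rmorphN mulNr.
have [c cP] := fin_all_exists fU.
pose a i := (c i).1.1; pose w i := (c i).2; pose N := (\prod_i (c i).1.2)%N.
have fE i : f i = ratr (a i) * w i by have [] := cP i.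
have N_gt0 : (N > 0)%N by apply: prodn_gt0 => i; have [] := cP i.
have wN1 i : w i ^+ N = 1.
  by have [_ w1 _] := cP i; rewrite /N (bigD1 i) //= exprM w1 expr1n.
have lt_j : (index y ws < size ws)%N by rewrite index_mem.
pose j : I := inr (Ordinal lt_j).
have fj : f j = - y by rewrite /= nth_index.
pose Z (B : {set I}) := (j \in B) && (\sum_(i in B) f i == 0).
have ZT : Z [set: I].
  rewrite /Z inE /=; apply/eqP; rewrite (eq_bigl predT) => [|i]; last by rewrite inE.
  rewrite big_sumType /= sumrN.
  have sum_nth (us : seq F) : \sum_(u <- us) u = \sum_(i < size us) us`_i.
    by rewrite (big_nth 0) big_mkord.
  by rewrite -!sum_nth eq_sum subrr.
have [A /minsetP[/andP[jA /eqP sumA] minA]] := ex_minset (ex_intro (fun B => is_true (Z B)) _ ZT).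
have minA' (B : {set I}) : B \proper A -> B != set0 -> \sum_(i in B) ratr (a i) * w i != 0.
  move=> prBA neB; apply/eqP => sumB.
  have {}sumB : \sum_(i in B) f i = 0 by rewrite -[RHS]sumB; apply: eq_bigr => i _.
  have sBA := proper_sub prBA; case: (boolP (j \in B)) => jB.
    have := minA B; rewrite /Z jB sumB eqxx => /(_ isT sBA) eqBA.
    by rewrite eqBA properxx in prBA.
  (* [A] is minimal only among the vanishing sets containing [j]. If [B] avoids [j], its complement
     in [A] vanishes and contains [j], so it equals [A] and [B] is empty. *)
  have := minA (A :\: B); rewrite /Z inE jB jA /= subsetDl => eqD.
  have sumD : \sum_(i in A :\: B) f i = 0.
    by have := sumA; rewrite (big_setID B) /= (setIidPr sBA) sumB add0r.
  have {}eqD := eqD (introT eqP sumD) isT.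
  have /set0Pn[x xB] := neB; have := subsetP sBA x xB.
  by rewrite -eqD inE xB.
have [k kA] : exists k : 'I_(size vs), inl k \in A.
  apply/existsP; rewrite -[X in is_true X]negbK negb_exists; apply/negP => /forallP noA.
  (* Positions out of range count as absent. *)
  pose Q k := if insub k is Some i then (inr i : I) \in A else false.
  have := irredundantP (P := Q) irr_ws; move=> /(_ _ (index y ws) lt_j) /negP; apply.
    apply/eqP; rewrite -oppr_eq0; apply/eqP; rewrite -[RHS]sumA big_sumType /=.
    rewrite [X in _ = X + _]big1 => [|i iA]; last by have := noA i; rewrite iA.
    by rewrite add0r -sumrN; apply: eq_bigl => i; rewrite /Q valK.
  by rewrite /Q (insubT (fun x => x < _)%N lt_j).
have sumA' : \sum_(i in A) ratr (a i) * w i = 0.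
  by rewrite -[RHS]sumA; apply: eq_bigr => i _.
have ratio := mann sumA' minA' N_gt0 (fun i _ => wN1 i) jA kA.
have /(prim_rootP prim_xi)[t defr] : (w j / w (inl k)) ^+ P = 1.
  have le_card : (#|A| <= size vs + size ws)%N.
    by rewrite (leq_trans (max_card _)) // card_sum !card_ord.
  have /dvdnP[m ->] := dvdn_trans (primorial_dvd le_card) P_dvd.
  by rewrite mulnC exprM ratio // expr1n.
have vk0 : vs`_k != 0 by apply: irredundant_neq0.
have vkE : vs`_k = ratr (a (inl k)) * w (inl k) by rewrite -fE.
have wk0 : w (inl k) != 0 by apply: contraNneq vk0 => w0; rewrite vkE w0 mulr0.
have ak0 : (ratr (a (inl k)) : F) != 0 by apply: contraNneq vk0 => a0; rewrite vkE a0 mul0r.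
exists vs`_k; first exact: mem_nth.
exists (- a j / a (inl k)); exists (t : nat) => //.
rewrite -defr vkE -[LHS]opprK -fj fE rmorphM rmorphN fmorphV /=.
by field; rewrite ak0 wk0.
Qed.

(** * Counting walks *)

Section Extensions.
Variables (T : eqType) (ext : seq T -> seq T).

(* The lists of length [k] are grown at the head, so a walk is listed from its end point. *)
Fixpoint extensions k : seq (seq T) :=
  if k is k'.+1 then [seq y :: p | p <- extensions k', y <- ext p] else [:: [::]].

Lemma mem_extensions_cons k y p :
  (y :: p \in extensions k.+1) = (p \in extensions k) && (y \in ext p).
Proof.
apply/allpairsPdep/andP => [[q [z [q_in z_in [-> ->]]]]|[]] //.
by move=> p_in y_in; exists p, y.
Qed.

Lemma extensions_uniq k : (forall p, uniq (ext p)) -> uniq (extensions k).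
Proof.
move=> uext; elim: k => //= k IH; apply: allpairs_uniq_dep => //.
by case=> p y [q z] _ _ /= [-> ->].
Qed.

Lemma size_mem_extensions k p : p \in extensions k -> size p = k.
Proof.
elim: k p => [|k IH] p; first by rewrite inE => /eqP ->.
by case/allpairsPdep => q [z [q_in _ ->]] /=; rewrite IH.
Qed.

Lemma size_extensions_ge c k :
  (forall i p, (i < k)%N -> p \in extensions i -> (c <= size (ext p))%N) ->
  (c ^ k <= size (extensions k))%N.
Proof.
elim: k => // k IH ge_c; rewrite /= size_allpairs_dep expnSr.
have {}IH := IH (fun i p lt_ik => ge_c i p (ltnW lt_ik)).
apply: (@leq_trans (size (extensions k) * c)); first by rewrite leq_mul2r IH orbT.
have {}ge_c p : p \in extensions k -> (c <= size (ext p))%N by apply: ge_c.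
elim: (extensions k) ge_c {IH} => //= p s IH ge_c.
rewrite mulSn leq_add ?ge_c ?mem_head // IH // => q q_s.
by rewrite ge_c // inE q_s orbT.
Qed.

Lemma size_extensions_le c k :
  (forall p, (size (ext p) <= c)%N) -> (size (extensions k) <= c ^ k)%N.
Proof.
move=> le_c; elim: k => // k IH; rewrite /= size_allpairs_dep expnSr.
apply: (@leq_trans (size (extensions k) * c)); last by rewrite leq_mul2r IH orbT.
by elim: (extensions k) => //= p s IHs; rewrite mulSn leq_add.
Qed.

End Extensions.

Lemma size_fibers (T U : eqType) (h : T -> U) (s : seq T) (V : seq U) K :
  uniq V -> {in s, forall x, h x \in V} ->
  (forall y, y \in V -> count (fun x => h x == y) s <= K)%N -> (size s <= size V * K)%N.
Proof.
elim: V s => [|y V IH] s /= => [_|/andP[y_V uV]] hV leK.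
  by case: s hV {leK} => // x s /(_ x (mem_head _ _)).
rewrite mulSn -(count_predC (fun x => h x == y)) leq_add ?leK ?mem_head //.
rewrite -size_filter; apply: IH => // [x|z zV].
  by rewrite mem_filter /= => /andP[ne /hV]; rewrite inE (negPf ne).
apply: leq_trans (leK z _); last by rewrite inE zV orbT.
by rewrite count_filter; apply: sub_count => x /= /andP[].
Qed.

Lemma count_has_le (T U : Type) (r : U -> pred T) (Z : seq U) (s : seq T) :
  (forall z, count (r z) s <= 1)%N -> (count (fun y => has (r^~ y) Z) s <= size Z)%N.
Proof.
move=> le1; elim: Z => [|z Z IH] /=; first by rewrite count_pred0.
apply: leq_trans (leq_add (le1 z) IH); rewrite -count_predUI; exact: leq_addr.
Qed.

Section Walks.
Variables (F : numClosedFieldType) (V : seq F) (nbr : F -> seq F) (D : nat).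
Hypothesis V_uniq : uniq V.
Hypothesis nbr_uniq : forall x, uniq (nbr x).
Hypothesis nbr_V : forall x, x \in V -> {subset nbr x <= V}.
Hypothesis nbr_irrefl : forall x, x \notin nbr x.
Hypothesis nbr_mult : forall x y, y \in nbr x -> mult_of_unity_root (y - x).
Hypothesis nbr_degree : forall x, x \in V -> (D <= size (nbr x))%N.
Hypothesis nbr_parallel : forall x y y' (q : rat),
  y \in nbr x -> y' \in nbr x -> y - x = ratr q * (y' - x) -> y = y'.

Variable x0 : F.
Hypothesis x0V : x0 \in V.

(** The starting point [x0] is not listed: the empty list is the walk staying at [x0], and
    [head x0 p] is always the end point. *)
Fixpoint steps (p : seq F) : seq F :=
  if p is y :: p' then (y - head x0 p') :: steps p' else [::].

Definition irr_ext (p : seq F) : seq F :=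
  [seq y <- nbr (head x0 p) | irredundant (steps (y :: p))].

(** Extensions by a step in one of the directions of [Z]. They encode the irredundant walks with a
    fixed end point. *)
Definition par_ext (Z p : seq F) : seq F :=
  [seq y <- nbr (head x0 p) |
     has (fun z => `[< exists q : rat, y - head x0 p = ratr q * z >]) Z].

Lemma size_steps p : size (steps p) = size p.
Proof. by elim: p => //= y p ->. Qed.

Lemma sum_steps p : \sum_(v <- steps p) v = head x0 p - x0.
Proof.
elim: p => [|y p IH] /=; first by rewrite big_nil subrr.
by rewrite big_cons IH addrA subrK.
Qed.

Lemma irr_walkP k p : p \in extensions irr_ext k ->
  [/\ head x0 p \in V, irredundant (steps p) & {in steps p, forall v, mult_of_unity_root v}].
Proof.
elim: k p => [|k IH] p; first by rewrite inE => /eqP ->.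
case: p => [/size_mem_extensions //|y p].
rewrite mem_extensions_cons mem_filter => /andP[/IH[hV irr mult] /andP[irr_y y_nbr]].
split=> //; first exact: nbr_V y_nbr.
by move=> v /=; rewrite inE => /orP[/eqP ->|/mult //]; apply: nbr_mult.
Qed.

(** A neighbour [y] of the end point [x] is lost only if [- (y - x)] is one of the 2^k subset sums
    of the earlier steps, and distinct neighbours use distinct sums. *)
Lemma size_irr_ext k p : p \in extensions irr_ext k -> (D - 2 ^ k <= size (irr_ext p))%N.
Proof.
move=> p_in; have [hV irr _] := irr_walkP p_in.
have sz_p := size_mem_extensions p_in; set x := head x0 p in hV.
rewrite size_filter leq_subLR addnC.
apply: leq_trans (nbr_degree hV) _.
rewrite -(count_predC (fun y => irredundant (steps (y :: p))) (nbr x)) leq_add2l.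
rewrite -sz_p -size_steps -size_subset_sums -size_filter -(size_map (fun y => - (y - x))).
apply: uniq_leq_size.
  rewrite map_inj_uniq ?filter_uniq // => y y' /oppr_inj /addIr //.
move=> v /mapP[y]; rewrite mem_filter /= -/x irr andbT negbK => /andP[mem_s _] ->.
exact: mem_s.
Qed.

(** Two neighbours in the same direction [z] have rationally proportional steps, so [nbr_parallel]
    identifies them. *)
Lemma size_par_ext Z p : (size (par_ext Z p) <= size Z)%N.
Proof.
rewrite size_filter; set x := head x0 p.
apply: (@count_has_le _ _ (fun z y => `[< exists q : rat, y - x = ratr q * z >])) => z.
rewrite -size_filter; set s := filter _ _.
have : uniq s by rewrite filter_uniq.
have : {in s &, forall y y', y = y'}.
  move=> y y'; rewrite !mem_filter => /andP[/asboolP[q yq] yN] /andP[/asboolP[q' yq'] yN'].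
  have q'0 : (ratr q' : F) != 0.
    apply/eqP => q0; move: yq'; rewrite q0 mul0r => /eqP; rewrite subr_eq0 => /eqP y'x.
    by move: (nbr_irrefl x); rewrite -{1}y'x yN'.
  apply: (@nbr_parallel x y y' (q / q')) => //.
  by rewrite yq yq' rmorphM fmorphV /= mulrA divfK.
case: s => [|y [|y' s]] // all_eq /=; rewrite inE => /andP[/norP[/eqP[]]].
by apply: all_eq; rewrite !inE eqxx ?orbT.
Qed.

Lemma irr_par_walk (Z : seq F) k p : p \in extensions irr_ext k ->
  {in steps p, forall v, has (fun z => `[< exists q : rat, v = ratr q * z >]) Z} ->
  p \in extensions (par_ext Z) k.
Proof.
elim: k p => [|k IH] p //; case: p => [/size_mem_extensions //|y p].
rewrite !mem_extensions_cons !mem_filter => /andP[p_in /andP[_ y_nbr]] par.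
rewrite IH // => [|v v_in]; last by apply: par; rewrite inE v_in orbT.
by rewrite y_nbr andbT; apply: par; rewrite mem_head.
Qed.

(** The left side bounds the number of irredundant walks from below. The walks are grouped by end
    point, and within a group all are compared with one fixed walk: this leaves [k * P] directions
    for each step, and the directions determine the walk. *)
Lemma walks_bound k :
  ((D - 2 ^ k) ^ k <= size V * (k * primorial (k + k)) ^ k)%N.
Proof.
set P := primorial (k + k).
apply: (@leq_trans (size (extensions irr_ext k))).
  apply: size_extensions_ge => i p lt_ik p_in.
  apply: leq_trans (size_irr_ext p_in); apply: leq_sub2l.
  by rewrite leq_exp2l // ltnW.
have [xi prim_xi] := closed_prim_root F (primorial_gt0 (k + k)).
apply: (@size_fibers _ _ (head x0)) => // [p /irr_walkP[] //|y yV].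
rewrite -size_filter; set L := filter _ _.
have L_uniq : uniq L.
  by rewrite filter_uniq // extensions_uniq // => p; rewrite filter_uniq.
case defL : L => [//|p0 L'].
have : p0 \in L by rewrite defL mem_head.
rewrite mem_filter => /andP[/eqP h0 p0_in]; have [_ irr0 mult0] := irr_walkP p0_in.
have sz0 := size_mem_extensions p0_in.
(* The directions that [mann_compare] allows: a step of the fixed walk [p0] turned by a P-th root of
   unity. *)
pose Z := [seq v * xi ^+ t | v <- steps p0, t <- iota 0 P].
have szZ : size Z = (k * P)%N by rewrite size_allpairs size_iota size_steps sz0.
rewrite -defL; apply: (@leq_trans (size (extensions (par_ext Z) k))); last first.
  by apply: size_extensions_le => p; rewrite -szZ size_par_ext.
apply: uniq_leq_size => // p; rewrite mem_filter => /andP[/eqP h_p p_in].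
have [_ irr_p mult_p] := irr_walkP p_in.
have sz_p := size_mem_extensions p_in.
have : {in steps p, forall v, has (fun z => `[< exists q : rat, v = ratr q * z >]) Z}.
  move=> v v_p; have [||u u_in [q [t lt_tP defv]]] :=
    mann_compare irr0 irr_p _ mult0 mult_p _ prim_xi v_p.
  - by rewrite !sum_steps h0 h_p.
  - by rewrite !size_steps sz0 sz_p.
  apply/hasP; exists (u * xi ^+ t); last by apply/asboolP; exists q.
  by apply: allpairs_f => //; rewrite mem_iota.
exact: irr_par_walk.
Qed.

End Walks.

(** * Dense subgraphs and neighbours in distinct directions *)

Section Edges.
Variables (T : eqType) (g : rel T).
Hypothesis g_sym : symmetric g.

Fixpoint edges (s : seq T) : nat :=
  if s is x :: s' then (count (g x) s' + edges s')%N else 0%N.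

(** Symmetry makes the count independent of the order of the list, so any vertex may be moved to the
    front. *)
Lemma edges_rem x s : x \in s -> edges s = (count (g x) (rem x s) + edges (rem x s))%N.
Proof.
elim: s => //= y s IH; rewrite inE; case: eqVneq => [-> //|ne] /= x_s.
rewrite (IH x_s) /= (permP (perm_to_rem x_s) (g y)) /= g_sym; lia.
Qed.

(** Deleting a vertex of degree at most [d] loses at most [d] edges and so keeps the strict
    inequality. The deletions stop before the list is empty, where it would read 0 < 0. *)
Lemma dense_sublist s d : uniq s -> (d * size s < edges s)%N ->
  exists s', [/\ s' != [::], uniq s', {subset s' <= s} &
                 {in s', forall x, (d < count (g x) s')%N}].
Proof.
move sz: (size s) => n; elim: n s sz => [|n IH] s sz us.
  by move/size0nil: sz => ->.
move=> dense; have [/allP all_d|/allPn[x x_s]] := boolP (all (fun x => d < count (g x) s)%N s).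
  by exists s; split=> //; rewrite -size_eq0 sz.
rewrite -leqNgt => deg_x.
have [||s' [ne us' sub deg]] := IH (rem x s) _ (rem_uniq _ us).
- by rewrite size_rem // sz.
- have le_count : (count (g x) (rem x s) <= count (g x) s)%N.
    by rewrite (permP (perm_to_rem x_s)) /= leq_addl.
  by move: dense; rewrite (edges_rem x_s); lia.
by exists s'; split=> // y /sub /mem_rem.
Qed.

End Edges.

(** Greedy choice: keep the first element, discard the at most [l] elements related to it, and
    repeat. *)
Lemma class_transversal (T : eqType) (r : rel T) (s : seq T) l :
  {in s, reflexive r} -> {in s &, symmetric r} ->
  {in s, forall y, (count (r y) s <= l)%N} ->
  exists s', [/\ subseq s' s, {in s' &, forall y y', r y y' -> y = y'} &
                 (size s <= l * size s')%N].
Proof.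
move sz: (size s) => n; elim/ltn_ind: n s sz => n IH [|y s] sz r_refl r_sym le_l.
  by exists [::]; split; rewrite -?sz.
pose s1 := [seq z <- s | ~~ r y z].
have sub1 : {subset s1 <= y :: s} by move=> z; rewrite mem_filter inE => /andP[_ ->]; rewrite orbT.
have [||||s' [sub' inj' size']] := IH (size s1) _ s1 erefl.
- by rewrite -sz ltnS size_filter count_size.
- by move=> z /sub1 /r_refl.
- by move=> z z' /sub1 zs /sub1; apply: r_sym.
- move=> z /sub1 zs; apply: leq_trans (le_l z zs); rewrite /= count_filter.
  apply: leq_trans (leq_addl _ _); apply: sub_count => x /=; by case/andP.
exists (y :: s'); split=> /=.
- by rewrite eqxx (subseq_trans sub') ?filter_subseq.
- have nr z : z \in s' -> ~~ r y z by move/(mem_subseq sub'); rewrite mem_filter => /andP[].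
  move=> z z'; rewrite !inE => /orP[/eqP->|zs] /orP[/eqP->|zs'] //.
  + by rewrite (negPf (nr _ zs')).
  + rewrite r_sym ?mem_head ?(negPf (nr _ zs)) //.
    exact/sub1/(mem_subseq sub').
  + exact: inj'.
have := le_l y (mem_head _ _); rewrite /= r_refl ?mem_head //.
have := count_predC (r y) s; rewrite -size_filter in size' *.
have : size s1 = count (predC (r y)) s by rewrite size_filter.
move: size' sz => /=; lia.
Qed.

(** A sublist [V'] with all degrees above [D * l] is found first; a transversal of the lines through
    each vertex then leaves more than [D] neighbours in distinct directions, and [walks_bound]
    applies with [D.+1]. *)
Lemma edges_bound (F : numClosedFieldType) (V : seq F) (g : rel F) (l D k : nat) :
  uniq V -> symmetric g -> irreflexive g ->
  (forall x y, g x y -> mult_of_unity_root (y - x)) ->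
  (forall x y, x \in V -> y \in V -> g x y ->
     count (fun y' => `[< exists q : rat, (y - x = ratr q * (y' - x))%R >]) V <= l)%N ->
  (D * l * size V < edges g V)%N ->
  ((D.+1 - 2 ^ k) ^ k <= size V * (k * primorial (k + k)) ^ k)%N.
Proof.
move=> uV g_sym g_irr g_mult line_le dense.
have [V' [ne uV' subV deg]] := dense_sublist g_sym uV dense.
pose par (x y y' : F) := `[< exists q : rat, y - x = ratr q * (y' - x) >].
(* Outside [V'] the list is empty, so the chosen [nbr] is total and its properties hold at every
   point of [F]. *)
pose P x (s : seq F) := if x \in V' then [/\ subseq s [seq y <- V' | g x y],
  {in s &, forall y y', par x y y' -> y = y'} & (D.+1 <= size s)%N] else s = [::].
have /choice[nbr nbrP] : forall x, exists s, P x s.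
  move=> x; rewrite /P; have [xV|_] := boolP (x \in V'); last by exists [::].
  have neq y : g x y -> y - x != 0.
    by apply: contraTneq => /eqP; rewrite subr_eq0 => /eqP ->; rewrite g_irr.
  have [|||s [sub inj sz]] := @class_transversal _ (par x) [seq y <- V' | g x y] l.
  - by move=> y _; apply/asboolP; exists 1; rewrite rmorph1 mul1r.
  - have half y y' : g x y -> par x y y' -> par x y' y.
      move=> gxy /asboolP[q defq]; apply/asboolP; exists q^-1.
      have q0 : (ratr q : F) != 0 by apply: contraNneq (neq _ gxy) => q0; rewrite defq q0 mul0r.
      by rewrite defq fmorphV mulKf.
    move=> y y'; rewrite !mem_filter => /andP[gy _] /andP[gy' _].
    by apply/idP/idP; apply: half.
  - move=> y; rewrite mem_filter => /andP[gy yV].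
    apply: leq_trans (line_le x y (subV _ xV) (subV _ yV) gy).
    rewrite count_filter; apply: (@leq_trans (count (par x y) V')).
      by apply: sub_count => z /andP[].
    rewrite -!size_filter; apply: uniq_leq_size; first exact: filter_uniq.
    by move=> z; rewrite !mem_filter => /andP[par_z /subV ->]; rewrite andbT.
  exists s; split=> //; have := deg x xV; rewrite -size_filter => lt.
  have := leq_trans lt sz; rewrite [(l * _)%N]mulnC ltn_mul2r => /andP[] //.
have nbr_mem x y : y \in nbr x -> [/\ x \in V', y \in V' & g x y].
  have := nbrP x; rewrite /P; case: ifP => [xV [sub _ _] /(mem_subseq sub)|_ -> //].
  by rewrite mem_filter => /andP[].
have [x0 x0V] : exists x0, x0 \in V'.
  by case: V' ne {uV' subV deg P nbrP nbr_mem} => // x s; exists x; rewrite mem_head.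
apply: leq_trans (_ : size V' * (k * primorial (k + k)) ^ k <= _)%N; last first.
  by rewrite leq_mul2r uniq_leq_size ?orbT.
apply: (walks_bound (nbr := nbr)) x0V _ => //.
- move=> x; have := nbrP x; rewrite /P; case: ifP => [xV [sub _ _]|_ -> //].
  exact: subseq_uniq sub (filter_uniq _ uV').
- by move=> x _ y /nbr_mem[].
- by move=> x; apply/negP => /nbr_mem[_ _]; rewrite g_irr.
- by move=> x y /nbr_mem[_ _ /g_mult].
- by move=> x xV; have := nbrP x; rewrite /P xV => -[].
- move=> x y y' q yN y'N eq_q; have [xV _ _] := nbr_mem _ _ yN.
  have := nbrP x; rewrite /P xV => -[_ inj _]; apply: inj => //.
  by apply/asboolP; exists q.
Qed.

(** * Points of the plane as complex numbers *)

Lemma IZR_intr z : exists m : int, IZR z = m%:~R.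
Proof.
case: z => [|p|p]; first by exists 0.
  by exists (Posz (nat_of_pos p)); rewrite IZRposE INRE.
by exists (- Posz (nat_of_pos p)); rewrite rmorphN -[X in - X]/((nat_of_pos p)%:R) -INRE -IZRposE.
Qed.

Lemma is_rational_ratr x : is_rational x -> exists q : rat, x = ratr q.
Proof.
case=> [[num den] ->]; rewrite /Q2R /=.
have [a ->] := IZR_intr num; have [b ->] := IZR_intr (Zpos den).
by exists (a%:~R / b%:~R); rewrite fmorph_div /= !ratr_int.
Qed.

Lemma complex_ratr (q : rat) : (ratr q : complex R) = real_complex R (ratr q).
Proof. by rewrite [RHS]fmorph_rat. Qed.

Lemma de_moivre t n :
  Complex (cos t) (sin t) ^+ n = Complex (cos (INR n * t)%coqR) (sin (INR n * t)%coqR).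
Proof.
elim: n => [|n IH]; first by rewrite expr0 Rmult_0_l cos_0 sin_0.
rewrite exprS IH S_INR Rmult_plus_distr_r Rmult_1_l Rplus_comm cos_plus sin_plus.
by congr Complex; apply: Rplus_comm.
Qed.

Lemma rational_angle_root (c : QArith_base.Q) : exists2 N : nat, (0 < N)%N &
  Complex (cos (PI * Q2R c)%coqR) (sin (PI * Q2R c)%coqR) ^+ N = 1.
Proof.
(* For the angle [PI * num / den], the power [2 * den] turns it into [num] full turns. *)
case: c => num den; exists (2 * Pos.to_nat den)%N.
  by rewrite muln_gt0 /=; apply/ssrnat.ltP/Pos2Nat.is_pos.
have sin0 : (sin (IZR num * PI) = 0)%coqR by apply: sin_eq_0_1; exists num.
rewrite de_moivre (_ : (_ * _)%coqR = (2 * (IZR num * PI))%coqR).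
  by rewrite cos_2a_sin sin_2a sin0 !Rmult_0_r Rmult_0_l Rminus_0_r.
rewrite /Q2R /= mult_INR INR_IPR -/(IZR (Zpos den)) /=.
have d0 : IZR (Zpos den) != 0 by apply/eqP/not_0_IZR.
by rewrite !(RmultE, RinvE, RplusE) -[IZR 2]/(IZR 1 + IZR 1); field.
Qed.

Lemma decPP P : reflect P (Defs.decP P).
Proof. by rewrite /Defs.decP; case: excluded_middle_informative => h; constructor. Qed.

Lemma dist2_sym p q : dist2 p q = dist2 q p.
Proof. by rewrite /dist2; f_equal; rewrite -!Rsqr_pow2 Rsqr_neg_minus (Rsqr_neg_minus (snd q)). Qed.

Lemma good_pair_sym p q : good_pair p q -> good_pair q p.
Proof.
case=> rat_d [ne [r [c [r_gt0 [ex ey]]]]]; split; first by rewrite dist2_sym.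
split; first by move=> /esym.
(* Reversing the segment adds [PI] to the angle, hence 1 to the rational [c]. *)
exists r, (QArith_base.Qplus c (QArith_base.Qmake 1 1)); split=> //.
have -> : (PI * Q2R (QArith_base.Qplus c (QArith_base.Qmake 1 1)) = PI * Q2R c + PI)%coqR.
  rewrite Qreals.Q2R_plus; rewrite [Q2R (QArith_base.Qmake 1 1)]/Q2R /=; lra.
by rewrite neg_cos neg_sin; split; nra.
Qed.

Definition to_complex (p : point) : complex R := Complex (fst p) (snd p).
Definition of_complex (z : complex R) : point := (complex.Re z, complex.Im z).

Lemma to_complexK : cancel to_complex of_complex.
Proof. by case. Qed.

(** Since [r] is positive it is the distance, hence rational, and the remaining factor on the unit
    circle is a root of unity. *)
Lemma good_pair_mult p q : good_pair p q -> mult_of_unity_root (to_complex q - to_complex p).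
Proof.
case=> rat_d [_ [r [c [r_gt0 [ex ey]]]]].
have dist_r : dist2 p q = r.
  rewrite /dist2 ex ey; set t := (PI * _)%coqR.
  have -> : ((r * cos t) ^ 2 + (r * sin t) ^ 2 = Rsqr r)%coqR.
    have := sin2_cos2 t; rewrite /Rsqr => cs.
    have -> : ((r * cos t) ^ 2 + (r * sin t) ^ 2 =
      r * r * (sin t * sin t + cos t * cos t))%coqR by lra.
    by rewrite cs Rmult_1_r.
  by apply: sqrt_Rsqr; lra.
rewrite dist_r in rat_d; have [a defr] := is_rational_ratr rat_d.
have [N N_gt0 w1] := rational_angle_root c.
exists a, N, (Complex (cos (PI * Q2R c)%coqR) (sin (PI * Q2R c)%coqR)); split=> //.
rewrite complex_ratr -defr; apply/eqP; rewrite eq_complex /=.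
by apply/andP; split; apply/eqP; rewrite mul0r ?subr0 ?addr0; [exact: ex | exact: ey].
Qed.

Lemma length_filter_decP (T : Type) (P : T -> Prop) s :
  length (List.filter (fun x => Defs.decP (P x)) s) = count (fun x => Defs.decP (P x)) s.
Proof. by elim: s => //= x s <-; case: (Defs.decP _). Qed.

Definition good_rel (x y : complex R) : bool := Defs.decP (good_pair (of_complex x) (of_complex y)).

Lemma count_good_pairs_edges s : count_good_pairs s = edges good_rel [seq to_complex p | p <- s].
Proof.
elim: s => //= x s ->; rewrite length_filter_decP count_map plusE; congr (_ + _)%N.
by apply: eq_count => y; rewrite /good_rel /= !to_complexK.
Qed.

Lemma edges_le (T : eqType) (g : rel T) s : (edges g s <= size s * size s)%N.
Proof.
elim: s => //= x s IH; have := count_size (g x) s; lia.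
Qed.

Lemma count_parallel_le (x y : complex R) (S : seq point) : x != y ->
  exists a b c : R, (a <> IZR 0 \/ b <> IZR 0) /\
  (count (fun z => `[< exists q : rat, (y - x = ratr q * (z - x))%R >])
     [seq to_complex p | p <- S] <= points_on_line a b c S)%N.
Proof.
case: x y => [xr xi] [yr yi] ne; pose dx := (yr - xr)%coqR; pose dy := (yi - xi)%coqR.
(* The line through [x] with direction [y - x], written by its normal vector. *)
exists (- dy)%coqR, dx, (- dy * xr + dx * xi)%coqR; split.
  apply: NNPP => /not_or_and[/NNPP a0 /NNPP b0].
  case/eqP: ne; apply/eqP; rewrite eq_complex.
  apply/andP; split; apply/eqP/esym/Rminus_diag_uniq; first exact: b0.
  by rewrite -/dy -[dy]Ropp_involutive a0 Ropp_0.
rewrite /points_on_line length_filter_decP count_map; apply: sub_count => p /= /asboolP[q eq_q].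
apply/decPP; move: eq_q; rewrite complex_ratr; move: (ratr q) => t.
move/eqP; rewrite eq_complex /= !mul0r subr0 addr0 => /andP[/eqP e1 /eqP e2].
have {}e1 : (dx = t * (fst p - xr))%coqR := e1.
have {}e2 : (dy = t * (snd p - xi))%coqR := e2.
rewrite e1 e2; lra.
Qed.

(** * Numerical estimates *)

Local Open Scope nat_scope.

(** Here 48 = 3 * 16, with 3 from the k-th root of n <= 3^(k^2) taken per step and 16 from the
    primorial of 2k. As 192 = 4 * 48, the spare power of 4 outgrows the linear factor. *)
Lemma degree_beats_codes k : 7 <= k -> 2 ^ k + k * 48 ^ k < 192 ^ k.-1.
Proof.
case: k => // k; rewrite ltnS /= => k_ge6.
have pow4 : 48 * k.+1 + 2 < 4 ^ k.
  elim: k k_ge6 => // k IH; rewrite leq_eqVlt => /orP[/eqP <- //|/IH lt].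
  by rewrite expnS; lia.
have le48 : 2 ^ k <= 48 ^ k by rewrite leq_exp2r // (leq_trans _ k_ge6).
rewrite -[X in _ < X ^ _]/(4 * 48) expnMn !expnS.
apply: (@leq_trans ((48 * k.+1 + 3) * 48 ^ k)).
  2: by rewrite leq_mul2r -addn1 -addnA in pow4 *; rewrite pow4 orbT.
have : 0 < 48 ^ k by rewrite expn_gt0.
rewrite mulnDl [k.+1 * _]mulnCA mulnA; lia.
Qed.

Lemma walk_count_contradiction n D k : 7 <= k -> n <= 3 ^ (k * k) -> 192 ^ k.-1 <= D ->
  (D - 2 ^ k) ^ k <= n * (k * primorial (k + k)) ^ k -> False.
Proof.
move=> k_ge7 le_n le_D; apply/negP; rewrite -ltnNge.
have k_gt0 : 0 < k by apply: leq_trans k_ge7.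
apply: (@leq_ltn_trans ((3 ^ k * (k * 16 ^ k)) ^ k)).
  rewrite [leqRHS]expnMn -expnM leq_mul // leq_exp2r // leq_mul //.
  by apply: leq_trans (primorial_le _) _; rewrite addnn -mul2n expnM.
rewrite ltn_exp2r // mulnCA -expnMn ltn_subRL.
exact: leq_trans (degree_beats_codes k_ge7) le_D.
Qed.

Lemma nat_floor (x : R) : (0 <= x)%coqR -> exists m, (INR m <= x < INR m.+1)%coqR.
Proof.
move=> x_ge0; have [lo hi] := base_Int_part x.
have z_ge0 : Z.le Z0 (Int_part x).
  by have : (-1 < IZR (Int_part x))%coqR; [lra | move/lt_IZR; lia].
exists (Z.to_nat (Int_part x)); rewrite S_INR INR_IZR_INZ Z2Nat.id //; lra.
Qed.

Lemma exp_nondecreasing x y : (x <= y)%coqR -> (exp x <= exp y)%coqR.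
Proof. by case=> [/exp_increasing/Rlt_le|->] //; apply: Rle_refl. Qed.

Lemma exp_natmul x m : exp (INR m * x)%coqR = (exp x ^ m)%coqR.
Proof.
elim: m => [|m IH]; first by rewrite Rmult_0_l exp_0.
by rewrite S_INR Rmult_plus_distr_r Rmult_1_l exp_plus IH /= Rmult_comm.
Qed.

(** From e^(1/4) >= 5/4, raised to the power 24. *)
Lemma exp6_ge : (192 <= exp 6)%coqR.
Proof.
have -> : (6 = INR 24 * (1 / 4))%coqR by rewrite INR_IZR_INZ /=; lra.
rewrite exp_natmul; have lo : (5 / 4 <= exp (1 / 4))%coqR.
  by have := exp_ineq1_le (1 / 4)%coqR; lra.
apply: Rle_trans (pow_incr _ _ 24 (conj _ lo)); lra.
Qed.

Lemma INR_expn a b : INR (a ^ b) = (INR a ^ b)%coqR.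
Proof. by elim: b => // b IH; rewrite expnS mult_INR IH. Qed.

(** The walk length [k] is the integer part of [s] plus 1: [k.-1 <= s] gives the lower bound on the
    degree, and [s < k] the upper bound on n = e^(s^2). *)
Lemma exponent_range s : (6 < s)%coqR -> exists k, 7 <= k /\ (INR k.-1 <= s < INR k)%coqR.
Proof.
move=> s_gt6; have [m [lo hi]] : exists m, (INR m <= s < INR m.+1)%coqR.
  by apply: nat_floor; lra.
exists m.+1; split=> //; rewrite ltnS leqNgt; apply/negP => lt_m6.
have : (INR m.+1 <= INR 6)%coqR by apply: le_INR; apply/ssrnat.leP.
have -> : INR 6 = IZR 6 by rewrite INR_IZR_INZ.
by move=> ?; lra.
Qed.

(** As ln N = s^2, the factor N^(6/s) is e^(6s). *)
Lemma Rpower_split (N alpha s : R) : (0 < s)%coqR -> (ln N = s * s)%coqR -> (0 < N)%coqR ->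
  Rpower N (1 + alpha + 6 / s)%coqR = (N * Rpower N alpha * exp (6 * s))%coqR.
Proof.
move=> s_gt0 lnN N_gt0; rewrite !Rpower_plus Rpower_1 //; congr (_ * _)%coqR.
rewrite /Rpower lnN; congr exp.
by rewrite /Rdiv Rmult_assoc -(Rmult_assoc (Rinv s)) Rinv_l ?Rmult_1_l; lra.
Qed.

(** * Assembly of the bound *)

Lemma NoDup_uniq (T : eqType) (s : seq T) : List.NoDup s -> uniq s.
Proof.
elim: s => //= x s IH /List.NoDup_cons_iff[x_s /IH ->]; rewrite andbT.
apply/negP => mem_x; apply: x_s; elim: s mem_x {IH} => //= y s IH.
by rewrite inE => /orP[/eqP ->|/IH]; [left | right].
Qed.

Lemma good_pairs_bound (alpha : R) (n : nat) (S : list point) :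
  (2 <= n)%coq_nat -> List.NoDup S -> length S = n ->
  (forall a b c : R, (a <> IZR 0 \/ b <> IZR 0) ->
      (INR (points_on_line a b c S) <= Rpower (INR n) alpha)%coqR) ->
  (0 <= alpha)%coqR ->
  (INR (count_good_pairs S) <= Rpower (INR n) (1 + alpha + 6 / sqrt (ln (INR n))))%coqR.
Proof.
move=> n_ge2 uS sz_S on_line alpha_ge0.
have N_ge2 : (2 <= INR n)%coqR by rewrite -[2%coqR]/(INR 2); apply: le_INR.
have lnN_gt0 : (0 < ln (INR n))%coqR by rewrite -ln_1; apply: ln_increasing; lra.
set s := sqrt _; have s_gt0 : (0 < s)%coqR by apply: sqrt_lt_R0.
have lnN : (ln (INR n) = s * s)%coqR by rewrite sqrt_sqrt //; lra.
pose V := [seq to_complex p | p <- S].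
have szV : size V = n by rewrite size_map.
have uV : uniq V.
  rewrite map_inj_uniq; last exact: can_inj to_complexK.
  exact: NoDup_uniq.
rewrite count_good_pairs_edges -/V.
(* For [s <= 6] the exponent is at least 2, and there are at most n^2 pairs. *)
have [s_le6|s_gt6] := Rle_or_lt s 6.
  apply: (@Rle_trans _ (INR (n * n))); first by apply/le_INR/ssrnat.leP; rewrite -szV edges_le.
  rewrite mult_INR -{1 2}[INR n]Rpower_1; try lra; rewrite -Rpower_plus.
  apply: Rle_Rpower; first by lra.
  suff : (1 <= 6 / s)%coqR by lra.
  by apply: (Rmult_le_reg_r s) => //; rewrite /Rdiv Rmult_assoc Rinv_l; lra.
apply: Rnot_lt_le; rewrite Rpower_split //; last by lra.
have pow_gt0 : (0 < Rpower (INR n) alpha)%coqR by apply: exp_pos.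
(* [l] and [D] are the integer parts of n^alpha and e^(6s). Rounding down keeps [D * l * n] below
   the number of edges, while a line still has at most [l] points because its count is an
   integer. *)
have [l [l_lo l_hi]] := nat_floor (Rlt_le _ _ pow_gt0).
have [D [D_lo D_hi]] := nat_floor (Rlt_le _ _ (exp_pos (6 * s)%coqR)).
move=> many; have dense : D * l * size V < edges good_rel V.
  apply/ssrnat.ltP/INR_lt; apply: Rle_lt_trans many; rewrite szV !mult_INR.
  rewrite Rmult_comm Rmult_assoc; apply: Rmult_le_compat_l; first exact: pos_INR.
  by rewrite Rmult_comm; apply: Rmult_le_compat => //; apply: pos_INR.
have good_sym : symmetric good_rel.
  by move=> x y; apply/decPP/decPP; apply: good_pair_sym.
have good_irr : irreflexive good_rel.
  by move=> x; apply/decPP => -[_ []].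
have good_mult x y : good_rel x y -> mult_of_unity_root (y - x)%R.
  by move/decPP/good_pair_mult; case: x y => [? ?] [].
have line_le x y : x \in V -> y \in V -> good_rel x y ->
    count (fun z => `[< exists q : rat, (y - x = ratr q * (z - x))%R >]) V <= l.
  move=> _ _ gxy; have ne : x != y by apply: contraTneq gxy => ->; rewrite good_irr.
  have [a [b [c [ab le_line]]]] := count_parallel_le S ne.
  apply: leq_trans le_line _; rewrite -ltnS; apply/ssrnat.ltP/INR_lt.
  exact: Rle_lt_trans (on_line a b c ab) l_hi.
have [k [k_ge7 [k_lo k_hi]]] := exponent_range s_gt6.
have := edges_bound k uV good_sym good_irr good_mult line_le dense.
rewrite szV; apply: walk_count_contradiction => //.
- apply/ssrnat.leP/INR_le; rewrite INR_expn -(exp_ln (INR n)); last by lra.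
  apply: (@Rle_trans _ (exp (INR (k * k)%N * 1)%coqR)).
    rewrite lnN; apply: exp_nondecreasing; rewrite mult_INR; nra.
  rewrite exp_natmul; apply: pow_incr; split; first exact/Rlt_le/exp_pos.
  by have := exp_le_3; rewrite [INR 3]INR_IZR_INZ.
(* The degree is [D.+1], which exceeds e^(6s) >= e^(6(k-1)) >= 192^(k-1). *)
- apply/ssrnat.leP/INR_le; rewrite INR_expn; apply: Rlt_le; apply: Rle_lt_trans D_hi.
  apply: (@Rle_trans _ (exp (INR k.-1 * 6)%coqR)); last by apply: exp_nondecreasing; lra.
  rewrite exp_natmul; apply: pow_incr; rewrite INR_IZR_INZ; split; first by apply: IZR_le.
  exact: exp6_ge.
Qed.

End RationalAngles.

Open Scope R_scope.

Theorem theorem3 (alpha : R) (n : nat) (S : list point) :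
  0 < alpha < 1 / 2 ->
  (2 <= n)%nat ->
  NoDup S ->
  length S = n ->
  (forall a b c : R, (a <> 0 \/ b <> 0) ->
      INR (points_on_line a b c S) <= Rpower (INR n) alpha) ->
  INR (count_good_pairs S) <=
    Rpower (INR n) (1 + alpha + 6 / sqrt (ln (INR n))).
Proof.
  intros [alpha_gt0 _] n_ge2 uS sz_S on_line.
  exact (RationalAngles.good_pairs_bound n_ge2 uS sz_S on_line (Rlt_le _ _ alpha_gt0)).
Qed.
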